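(* Let $H$ be a weak Hopf algebra over a field $\Bbbk$ and let $C$ be a (left) $H$-comodule coalgebra via $\rho:C\to H\otimes C$, $\rho(c)=c^{-1}\otimes c^{0}$. Let $D\subseteq C$ be a subcoalgebra and let $\pi:C\to C$ be a linear projection onto $D$, i.e. $\pi(\pi(c))=\pi(c)$ for all $c\in C$ and $\operatorname{Im}\pi=D$. Then $D$ is a (left) symmetric partial $H$-comodule coalgebra via $$\overline{\rho}:D\to H\otimes D,\qquad \overline{\rho}(d)=(I_H\otimes\pi)\rho(d)=d^{-1}\otimes\pi(d^{0})$$ if and only if $\pi$ satisfies, for all $d\in D$: (i) $d^{-1}\otimes\Delta_D(\pi(d^{0}))=d^{-1}\otimes(\pi\otimes\pi)(\Delta_C(d^{0}))$; (ii) $$\begin{aligned} d^{-1}\otimes{\pi(d^{0})}^{-1}\otimes\pi({\pi(d^{0})}^{0})&={d_1}^{-1}\varepsilon_D(\pi({d_1}^{0})){{d_2}^{-1}}_1\otimes{{d_2}^{-1}}_2\otimes\pi({d_2}^{0})\\&={{d_1}^{-1}}_1{d_2}^{-1}\varepsilon_D(\pi({d_2}^{0}))\otimes{{d_1}^{-1}}_2\otimes\pi({d_1}^{0}).\end{aligned}$$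
   Context: All tensor products are over the field $\Bbbk$, all maps are $\Bbbk$-linear, and $V\otimes\Bbbk\simeq V\simeq\Bbbk\otimes V$ is used as an identification; coalgebras are coassociative and counital; Sweedler notation $\Delta(h)=h_1\otimes h_2$ is used, and $\tau_{V,W}:V\otimes W\to W\otimes V$ is the flip. $I_V$ is the identity map of $V$. A weak bialgebra $(H,m,u,\Delta,\varepsilon)$ is a vector space that is both an algebra and a coalgebra such that for all $h,k,\ell\in H$: (i) $\Delta(hk)=\Delta(h)\Delta(k)$; (ii) $\varepsilon(hk\ell)=\varepsilon(hk_1)\varepsilon(k_2\ell)=\varepsilon(hk_2)\varepsilon(k_1\ell)$; (iii) $(1_H\otimes\Delta(1_H))(\Delta(1_H)\otimes 1_H)=(\Delta(1_H)\otimes 1_H)(1_H\otimes\Delta(1_H))=\Delta^2(1_H)$, where $\Delta^2=(\Delta\otimes I)\Delta$. With $\Delta(1_H)=1_1\otimes 1_2$, define $\varepsilon_t(h)=\varepsilon(1_1h)1_2$ and $\varepsilon_s(h)=1_1\varepsilon(h1_2)$. A weak Hopf algebra is a weak bialgebra with a linear map $S:H\to H$ (antipode) such that $h_1S(h_2)=\varepsilon_t(h)$, $S(h_1)h_2=\varepsilon_s(h)$, $S(h_1)h_2S(h_3)=S(h)$ for all $h\in H$. A coalgebra $C$ is a (left) $H$-comodule coalgebra via a linear map $\rho:C\to H\otimes C$ if for all $c\in C$: (CC1) $(\varepsilon_H\otimes I_C)\rho(c)=c$; (CC2) $(I_H\otimes\Delta_C)\rho(c)=(m_H\otimes I_C\otimes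 I_C)(I_H\otimes\tau_{C,H}\otimes I_C)(\rho\otimes\rho)\Delta_C(c)$; (CC3) $(I_H\otimes\rho)\rho(c)=(\Delta_H\otimes I_C)\rho(c)$; (CC4) $(I_H\otimes\varepsilon_C)\rho(c)=(\varepsilon_t\otimes\varepsilon_C)\rho(c)$. A coalgebra $D$ is a (left) partial $H$-comodule coalgebra via a linear map $\overline{\rho}:D\to H\otimes D$ if for all $d\in D$: (CCP1) $(\varepsilon_H\otimes I_D)\overline{\rho}(d)=d$; (CCP2) $(I_H\otimes\Delta_D)\overline{\rho}(d)=(m_H\otimes I_D\otimes I_D)(I_H\otimes\tau_{D,H}\otimes I_D)(\overline{\rho}\otimes\overline{\rho})\Delta_D(d)$; (CCP3) $(I_H\otimes\overline{\rho})\overline{\rho}(d)=(m_H\otimes I_H\otimes I_D)[(I_H\otimes\varepsilon_D)(\overline{\rho}(d_1))\otimes(\Delta_H\otimes I_D)(\overline{\rho}(d_2))]$. It is symmetric if in addition $(I_H\otimes\overline{\rho})\overline{\rho}(d)=(m_H\otimes I_H\otimes I_D)(I_H\otimes\tau_{H\otimes D,H})[(\Delta_H\otimes I_D)(\overline{\rho}(d_1))\otimes(I_H\otimes\varepsilon_D)(\overline{\rho}(d_2))]$ for all $d\in D$. *)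

(* Defs.v *)
From HB Require Import structures.
From mathcomp Require Import all_boot all_order all_algebra.
From mathcomp Require Import boolp.

Set Implicit Arguments.
Unset Strict Implicit.
Unset Printing Implicit Defensive.

Import GRing.Theory.

Local Open Scope ring_scope.
Local Open Scope quotient_scope.

Reserved Notation "V ⊗ W" (at level 45, right associativity).
Reserved Notation "x • y" (at level 40, left associativity).
Reserved Notation "\sweedler_ ( x ; y <- t ) E"
  (at level 46, x name, y name, t at level 99, E at level 46,
   format "'[' \sweedler_ ( x ;  y  <-  t ) '/  '  E ']'").

(* The tensor product is the quotient of the formal sums [:: (v_1, w_1); ...]
   by the congruence generated by the bilinearity relations. *)

Section TensorCongruence.
Context (k : fieldType) (V W : lmodType k).
Implicit Types (s t : seq (V * W)).

Inductive tensor_eq : seq (V * W) -> seq (V * W) -> Prop :=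
| TensorRefl s : tensor_eq s s
| TensorSym s t : tensor_eq s t -> tensor_eq t s
| TensorTrans s t r : tensor_eq s t -> tensor_eq t r -> tensor_eq s r
| TensorCat s s' t t' :
    tensor_eq s s' -> tensor_eq t t' -> tensor_eq (s ++ t) (s' ++ t')
| TensorCatC s t : tensor_eq (s ++ t) (t ++ s)
| TensorAddl v v' w : tensor_eq [:: (v + v', w)] [:: (v, w); (v', w)]
| TensorAddr v w w' : tensor_eq [:: (v, w + w')] [:: (v, w); (v, w')]
| TensorScale a v w : tensor_eq [:: (a *: v, w)] [:: (v, a *: w)]
| TensorZero w : tensor_eq [:: (0, w)] [::].

Definition tensor_eqb s t : bool := `[< tensor_eq s t >].

Lemma tensor_eqb_refl : reflexive tensor_eqb.
Proof. by move=> s; apply/asboolP; exact: TensorRefl. Qed.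

Lemma tensor_eqb_sym : symmetric tensor_eqb.
Proof.
by move=> s t; apply/asboolP/asboolP => st; exact: TensorSym.
Qed.

Lemma tensor_eqb_trans : transitive tensor_eqb.
Proof.
move=> t s r /asboolP st /asboolP tr; apply/asboolP; exact: TensorTrans st tr.
Qed.

Canonical tensor_equiv :=
  EquivRel tensor_eqb tensor_eqb_refl tensor_eqb_sym tensor_eqb_trans.

Definition tensor : Type := {eq_quot tensor_equiv}.

HB.instance Definition _ := Choice.on tensor.
HB.instance Definition _ := Quotient.on tensor.

End TensorCongruence.

Arguments tensor {k} (V W)%_type.
Notation "V ⊗ W" := (tensor V W) : type_scope.

Section TensorModule.
Context (k : fieldType) (V W : lmodType k).
Implicit Types (s r : seq (V * W)) (t u : V ⊗ W) (a b : k).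

Definition tensor_class s : V ⊗ W := \pi_(V ⊗ W) s.

Lemma tensor_class_repr t : tensor_class (repr t) = t.
Proof. exact: reprK. Qed.

Lemma tensor_classP s r : tensor_class s = tensor_class r <-> tensor_eq s r.
Proof.
split=> [/eqmodP/asboolP //|sr].
by apply/eqmodP; apply/asboolP.
Qed.

Lemma repr_tensor_class s : tensor_eq (repr (tensor_class s)) s.
Proof. by apply/tensor_classP; rewrite tensor_class_repr. Qed.

Definition scale_seq a s : seq (V * W) := [seq (a *: p.1, p.2) | p <- s].

Lemma tensor_eq_scale a s r :
  tensor_eq s r -> tensor_eq (scale_seq a s) (scale_seq a r).
Proof.
elim=> {s r} [s|s r _|s r q _ sr _ rq|s s' r r' _ ss _ rr|s r|v v' w|v w w'|b v w|w].
- exact: TensorRefl.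
- exact: TensorSym.
- exact: TensorTrans sr rq.
- by rewrite /scale_seq !map_cat; exact: TensorCat.
- by rewrite /scale_seq !map_cat; exact: TensorCatC.
- by rewrite /= scalerDr; exact: TensorAddl.
- exact: TensorAddr.
- by rewrite /= scalerA mulrC -scalerA; exact: TensorScale.
- by rewrite /= scaler0; exact: TensorZero.
Qed.

Definition tensor_zero : V ⊗ W := tensor_class [::].
Definition tensor_add t u : V ⊗ W := tensor_class (repr t ++ repr u).
Definition tensor_scale a t : V ⊗ W := tensor_class (scale_seq a (repr t)).
Definition tensor_opp t : V ⊗ W := tensor_scale (-1) t.

Lemma tensor_addE s r :
  tensor_add (tensor_class s) (tensor_class r) = tensor_class (s ++ r).
Proof.
by apply/tensor_classP; apply: TensorCat; exact: repr_tensor_class.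
Qed.

Lemma tensor_scaleE a s :
  tensor_scale a (tensor_class s) = tensor_class (scale_seq a s).
Proof.
by apply/tensor_classP; apply: tensor_eq_scale; exact: repr_tensor_class.
Qed.

Lemma tensor_class_ind (Q : V ⊗ W -> Prop) :
  (forall s, Q (tensor_class s)) -> forall t, Q t.
Proof. by move=> Qs t; rewrite -(tensor_class_repr t). Qed.

Lemma tensor_addA : associative tensor_add.
Proof.
elim/tensor_class_ind=> s; elim/tensor_class_ind=> r; elim/tensor_class_ind=> q.
by rewrite !tensor_addE catA.
Qed.

Lemma tensor_addC : commutative tensor_add.
Proof.
elim/tensor_class_ind=> s; elim/tensor_class_ind=> r.
by rewrite !tensor_addE; apply/tensor_classP; exact: TensorCatC.
Qed.

Lemma tensor_add0 : left_id tensor_zero tensor_add.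
Proof. by elim/tensor_class_ind=> s; rewrite tensor_addE. Qed.

Lemma tensor_scaleDl_seq a b s :
  tensor_eq (scale_seq (a + b) s) (scale_seq a s ++ scale_seq b s).
Proof.
elim: s => [|[v w] s IHs]; first exact: TensorRefl.
rewrite [X in tensor_eq X _]/= -cat1s scalerDl.
apply: TensorTrans (TensorCat (TensorAddl _ _ _) IHs) _.
rewrite -[scale_seq a (_ :: _)]cat1s -[scale_seq b (_ :: _)]cat1s.
rewrite -[[:: _; _]]cat1s -!catA.
apply: TensorCat; first exact: TensorRefl.
rewrite !catA; apply: TensorCat; last exact: TensorRefl.
exact: TensorCatC.
Qed.

Lemma tensor_scale0_seq s : tensor_eq (scale_seq 0 s) [::].
Proof.
elim: s => [|[v w] s IHs]; first exact: TensorRefl.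
rewrite [X in tensor_eq X _]/= -cat1s scale0r.
exact: TensorCat (TensorZero _ _) IHs.
Qed.

Lemma scale_seq1 s : scale_seq 1 s = s.
Proof. by rewrite -[RHS]map_id; apply: eq_map => -[v w]; rewrite scale1r. Qed.

Lemma tensor_addN : left_inverse tensor_zero tensor_opp tensor_add.
Proof.
elim/tensor_class_ind=> s; rewrite /tensor_opp tensor_scaleE tensor_addE.
apply/tensor_classP; rewrite -[X in _ ++ X]scale_seq1.
apply: TensorTrans (TensorSym (tensor_scaleDl_seq _ _ _)) _.
by rewrite addNr; exact: tensor_scale0_seq.
Qed.

HB.instance Definition _ := GRing.isZmodule.Build (V ⊗ W)
  tensor_addA tensor_addC tensor_add0 tensor_addN.

Lemma tensor_scaleA a b t :
  tensor_scale a (tensor_scale b t) = tensor_scale (a * b) t.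
Proof.
elim/tensor_class_ind: t => s; rewrite !tensor_scaleE /scale_seq -map_comp.
by congr tensor_class; apply: eq_map => p; rewrite /= scalerA.
Qed.

Lemma tensor_scale1 : left_id 1 tensor_scale.
Proof. by elim/tensor_class_ind=> s; rewrite tensor_scaleE scale_seq1. Qed.

Lemma tensor_scaleDr : right_distributive tensor_scale +%R.
Proof.
move=> a; elim/tensor_class_ind=> s; elim/tensor_class_ind=> r.
by rewrite /GRing.add/= tensor_addE !tensor_scaleE tensor_addE /scale_seq map_cat.
Qed.

Lemma tensor_scaleDl t : {morph tensor_scale^~ t : a b / a + b}.
Proof.
move=> a b; elim/tensor_class_ind: t => s; rewrite !tensor_scaleE.
rewrite [RHS]/GRing.add/= tensor_addE.
by apply/tensor_classP; exact: tensor_scaleDl_seq.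
Qed.

HB.instance Definition _ := GRing.Zmodule_isLmodule.Build k (V ⊗ W)
  tensor_scaleA tensor_scale1 tensor_scaleDr tensor_scaleDl.

Definition pure_tensor (v : V) (w : W) : V ⊗ W := tensor_class [:: (v, w)].

End TensorModule.

Notation "v ⊗ w" := (pure_tensor v w) : ring_scope.

(* Sweedler summation: if t = \sum_i v_i ⊗ w_i then
   \sweedler_(x; y <- t) E x y = \sum_i E v_i w_i. The value does not depend on
   the decomposition of t as soon as E is bilinear (lemma sweedler_class). *)
Definition sweedler (k : fieldType) (V W : lmodType k) (X : zmodType)
  (t : V ⊗ W) (f : V -> W -> X) : X := \sum_(p <- repr t) f p.1 p.2.

Notation "\sweedler_ ( x ; y <- t ) E" :=
  (sweedler t (fun x y => E)) : ring_scope.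

Section TensorTheory.
Context (k : fieldType) (V W : lmodType k).

Lemma pure_tensor_bilinear :
  bilinear_for *:%R *:%R (@pure_tensor k V W).
Proof.
have scaleE a (v : V) (w : W) : a *: (v ⊗ w) = (a *: v) ⊗ w.
  exact: tensor_scaleE.
split=> [w a v v'|v a w w']; rewrite /= scaleE /GRing.add/= tensor_addE.
  by apply/tensor_classP; exact: TensorAddl.
apply/tensor_classP; apply: TensorTrans (TensorAddr _ _ _) _.
exact: (TensorCat (TensorSym (TensorScale _ _ _)) (TensorRefl [:: (v, w')])).
Qed.

HB.instance Definition _ := bilinear_isBilinear.Build k V W (V ⊗ W)%type
  _ _ (@pure_tensor k V W) pure_tensor_bilinear.

Lemma tensor_class_sum (s : seq (V * W)) :
  tensor_class s = \sum_(p <- s) (p.1 ⊗ p.2).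
Proof.
elim: s => [|[v w] s IHs]; first by rewrite big_nil.
by rewrite big_cons -IHs /GRing.add/= tensor_addE.
Qed.

Lemma tensor_sum (t : V ⊗ W) : t = \sum_(p <- repr t) (p.1 ⊗ p.2).
Proof. by rewrite -tensor_class_sum tensor_class_repr. Qed.

Lemma tensor_ind (Q : V ⊗ W -> Prop) :
  Q 0 -> (forall t u, Q t -> Q u -> Q (t + u)) -> (forall v w, Q (v ⊗ w)) ->
  forall t, Q t.
Proof.
by move=> Q0 QD Qp t; rewrite [t]tensor_sum; apply: big_ind => // p _.
Qed.

Section Sweedler.
Context (X : lmodType k) (f : V -> W -> X).

Lemma sweedler_class (s : seq (V * W)) : bilinear_for *:%R *:%R f ->
  sweedler (tensor_class s) f = \sum_(p <- s) f p.1 p.2.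
Proof.
case=> fl fr.
have f0 w : f 0 w = 0.
  by have := fl w (-1) 0 0; rewrite /= scaler0 addr0 scaleN1r addNr.
have f0' v : f v 0 = 0.
  by have := fr v (-1) 0 0; rewrite /= scaler0 addr0 scaleN1r addNr.
suff eqP r q : tensor_eq r q ->
    \sum_(p <- r) f p.1 p.2 = \sum_(p <- q) f p.1 p.2.
  exact/eqP/repr_tensor_class.
elim=> {r q} [//|r q _ -> //|||||||].
- by move=> p q r _ -> _ ->.
- by move=> p p' q q' _ pp _ qq; rewrite !big_cat /= pp qq.
- by move=> p q; rewrite !big_cat /= addrC.
- move=> v v' w; rewrite !big_cons !big_nil !addr0 /=.
  by have := fl w 1 v v'; rewrite /= !scale1r.
- move=> v w w'; rewrite !big_cons !big_nil !addr0 /=.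
  by have := fr v 1 w w'; rewrite /= !scale1r.
- move=> a v w; rewrite !big_cons !big_nil !addr0 /=.
  have := fl w a v 0; have := fr v a w 0.
  by rewrite /= f0 f0' !addr0 => -> ->.
- by move=> w; rewrite !big_cons !big_nil addr0.
Qed.

Lemma sweedler_pure v w : bilinear_for *:%R *:%R f ->
  sweedler (v ⊗ w) f = f v w.
Proof. by move=> fb; rewrite sweedler_class// big_seq1. Qed.

Lemma sweedler_linear : bilinear_for *:%R *:%R f -> linear (fun t => sweedler t f).
Proof.
move=> fb a; elim/tensor_class_ind=> s; elim/tensor_class_ind=> r.
have -> : a *: tensor_class s + tensor_class r =
    tensor_class (scale_seq a s ++ r).
  by rewrite /GRing.scale/= tensor_scaleE /GRing.add/= tensor_addE.
rewrite !sweedler_class// big_cat big_map scaler_sumr; congr (_ + _).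
case: fb => fl _; apply: eq_bigr => -[v w] _ /=.
have f0 : f 0 w = 0.
  by have := fl w (-1) 0 0; rewrite /= scaler0 addr0 scaleN1r addNr.
by have := fl w a v 0; rewrite /= f0 !addr0.
Qed.

End Sweedler.
End TensorTheory.

Section TensorMaps.
Context (k : fieldType).

Definition tmap (V V' W W' : lmodType k) (f : V -> V') (g : W -> W')
  (t : V ⊗ W) : V' ⊗ W' := \sweedler_(v; w <- t) f v ⊗ g w.

Definition tassoc (U V W : lmodType k) (t : (U ⊗ V) ⊗ W) : U ⊗ V ⊗ W :=
  \sweedler_(uv; w <- t) \sweedler_(u; v <- uv) u ⊗ v ⊗ w.

Definition tassocV (U V W : lmodType k) (t : U ⊗ V ⊗ W) : (U ⊗ V) ⊗ W :=
  \sweedler_(u; vw <- t) \sweedler_(v; w <- vw) (u ⊗ v) ⊗ w.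

Definition tflip (V W : lmodType k) (t : V ⊗ W) : W ⊗ V :=
  \sweedler_(v; w <- t) w ⊗ v.

Definition tlunit (V : lmodType k) (t : k^o ⊗ V) : V :=
  \sweedler_(a; v <- t) (a : k) *: v.

Definition trunit (V : lmodType k) (t : V ⊗ k^o) : V :=
  \sweedler_(v; a <- t) (a : k) *: v.

End TensorMaps.

Arguments tmap {k} {V V' W W'}%_type f g t.
Arguments tassoc {k} {U V W}%_type t.
Arguments tassocV {k} {U V W}%_type t.
Arguments tflip {k} {V W}%_type t.
Arguments tlunit {k} {V}%_type t.
Arguments trunit {k} {V}%_type t.

Section TensorMapsTheory.
Context (k : fieldType).

Lemma purePl (V W : lmodType k) a (v v' : V) (w : W) :
  (a *: v + v') ⊗ w = a *: (v ⊗ w) + v' ⊗ w.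
Proof. exact: (pure_tensor_bilinear V W).1. Qed.

Lemma purePr (V W : lmodType k) a (v : V) (w w' : W) :
  v ⊗ (a *: w + w') = a *: (v ⊗ w) + v ⊗ w'.
Proof. exact: (pure_tensor_bilinear V W).2. Qed.

Section PureTensor.
Context (V W : lmodType k) (v v' : V) (w w' : W).

Lemma pureDl : (v + v') ⊗ w = v ⊗ w + v' ⊗ w.
Proof. by have := purePl 1 v v' w; rewrite !scale1r. Qed.

Lemma pureDr : v ⊗ (w + w') = v ⊗ w + v ⊗ w'.
Proof. by have := purePr 1 v w w'; rewrite !scale1r. Qed.

Lemma pure0l : (0 : V) ⊗ w = 0.
Proof. by have := purePl (-1) (0 : V) 0 w; rewrite scaler0 addr0 scaleN1r addNr. Qed.

Lemma pure0r : v ⊗ (0 : W) = 0.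
Proof. by have := purePr (-1) v (0 : W) 0; rewrite scaler0 addr0 scaleN1r addNr. Qed.

Lemma pureZl a : (a *: v) ⊗ w = a *: (v ⊗ w).
Proof. by rewrite -[a *: v]addr0 purePl pure0l addr0. Qed.

Lemma pureZr a : v ⊗ (a *: w) = a *: (v ⊗ w).
Proof. by rewrite -[a *: w]addr0 purePr pure0r addr0. Qed.

End PureTensor.

Lemma sum_linear (X Y : lmodType k) I (r : seq I) (f : I -> X -> Y) :
  (forall i, linear (f i)) -> linear (fun x => \sum_(i <- r) f i x).
Proof.
move=> fl a x y; rewrite scaler_sumr -big_split.
by apply: eq_bigr => i _; rewrite fl.
Qed.

Lemma sweedler_linear_param (V W X Y : lmodType k) (f : X -> V -> W -> Y)
    (t : V ⊗ W) :
  (forall v w, linear (fun x => f x v w)) ->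
  linear (fun x => sweedler t (f x)).
Proof. by move=> fl; apply: sum_linear => p; exact: fl. Qed.

Section Map.
Context (V V' W W' : lmodType k) (f : {linear V -> V'}) (g : {linear W -> W'}).

Lemma tmap_bilinear :
  bilinear_for *:%R *:%R (fun (v : V) (w : W) => f v ⊗ g w).
Proof. by split=> [w|v] a x y /=; rewrite linearP ?purePl ?purePr. Qed.

Lemma tmap_linear : linear (tmap f g).
Proof. exact/sweedler_linear/tmap_bilinear. Qed.

HB.instance Definition _ :=
  GRing.isLinear.Build k (V ⊗ W)%type (V' ⊗ W')%type *:%R (tmap f g) tmap_linear.

Lemma tmapE v w : tmap f g (v ⊗ w) = f v ⊗ g w.
Proof. exact/sweedler_pure/tmap_bilinear. Qed.
End Map.

Section Assoc.
Context (U V W : lmodType k).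

Let assoc1 (w : W) :
  bilinear_for *:%R *:%R (fun (u : U) (v : V) => u ⊗ v ⊗ w).
Proof. by split=> [v|u] a x y /=; rewrite ?purePl ?purePr. Qed.

Lemma tassoc_bilinear : bilinear_for *:%R *:%R
  (fun (uv : U ⊗ V) (w : W) => \sweedler_(u; v <- uv) u ⊗ v ⊗ w).
Proof.
split=> [w|uv]; first exact/sweedler_linear/assoc1.
by apply: sweedler_linear_param => u v a x y; rewrite !purePr.
Qed.

Lemma tassoc_linear : linear (@tassoc k U V W).
Proof. exact/sweedler_linear/tassoc_bilinear. Qed.

HB.instance Definition _ := GRing.isLinear.Build k ((U ⊗ V) ⊗ W)%type (U ⊗ V ⊗ W)%type
  *:%R (@tassoc k U V W) tassoc_linear.

Lemma tassocE (u : U) (v : V) (w : W) : tassoc ((u ⊗ v) ⊗ w) = u ⊗ v ⊗ w.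
Proof.
by rewrite [LHS](sweedler_pure _ _ tassoc_bilinear) (sweedler_pure _ _ (assoc1 w)).
Qed.

Let assocV1 (u : U) :
  bilinear_for *:%R *:%R (fun (v : V) (w : W) => (u ⊗ v) ⊗ w).
Proof. by split=> [w|v] a x y /=; rewrite ?(purePl, purePr). Qed.

Lemma tassocV_bilinear : bilinear_for *:%R *:%R
  (fun (u : U) (vw : V ⊗ W) => \sweedler_(v; w <- vw) (u ⊗ v) ⊗ w).
Proof.
split=> [vw|u]; last exact/sweedler_linear/assocV1.
by apply: sweedler_linear_param => v w a x y; rewrite !purePl.
Qed.

Lemma tassocV_linear : linear (@tassocV k U V W).
Proof. exact/sweedler_linear/tassocV_bilinear. Qed.

HB.instance Definition _ := GRing.isLinear.Build k (U ⊗ V ⊗ W)%type ((U ⊗ V) ⊗ W)%type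
  *:%R (@tassocV k U V W) tassocV_linear.

Lemma tassocVE (u : U) (v : V) (w : W) : tassocV (u ⊗ v ⊗ w) = (u ⊗ v) ⊗ w.
Proof.
by rewrite [LHS](sweedler_pure _ _ tassocV_bilinear) (sweedler_pure _ _ (assocV1 u)).
Qed.
End Assoc.

Section FlipUnit.
Context (V W : lmodType k).

Lemma tflip_bilinear :
  bilinear_for *:%R *:%R (fun (v : V) (w : W) => w ⊗ v).
Proof. by split=> [w|v] a x y /=; rewrite ?purePl ?purePr. Qed.

Lemma tflip_linear : linear (@tflip k V W).
Proof. exact/sweedler_linear/tflip_bilinear. Qed.

HB.instance Definition _ := GRing.isLinear.Build k (V ⊗ W)%type (W ⊗ V)%type
  *:%R (@tflip k V W) tflip_linear.

Lemma tflipE (v : V) (w : W) : tflip (v ⊗ w) = w ⊗ v.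
Proof. exact/sweedler_pure/tflip_bilinear. Qed.

Lemma tlunit_bilinear :
  bilinear_for *:%R *:%R (fun (a : k^o) (v : V) => (a : k) *: v).
Proof.
split=> [v|b] a x y /=; first by rewrite scalerDl scalerA.
by rewrite scalerDr !scalerA mulrC.
Qed.

Lemma tlunit_linear : linear (@tlunit k V).
Proof. exact/sweedler_linear/tlunit_bilinear. Qed.

HB.instance Definition _ := GRing.isLinear.Build k (k^o ⊗ V)%type V
  *:%R (@tlunit k V) tlunit_linear.

Lemma tlunitE (a : k^o) (v : V) : tlunit (a ⊗ v) = (a : k) *: v.
Proof. exact: (sweedler_pure _ _ tlunit_bilinear). Qed.

Lemma trunit_bilinear :
  bilinear_for *:%R *:%R (fun (v : V) (a : k^o) => (a : k) *: v).
Proof. by case: tlunit_bilinear => l r; split. Qed.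

Lemma trunit_linear : linear (@trunit k V).
Proof. exact/sweedler_linear/trunit_bilinear. Qed.

HB.instance Definition _ := GRing.isLinear.Build k (V ⊗ k^o)%type V
  *:%R (@trunit k V) trunit_linear.

Lemma trunitE (v : V) (a : k^o) : trunit (v ⊗ a) = (a : k) *: v.
Proof. exact: (sweedler_pure _ _ trunit_bilinear). Qed.
End FlipUnit.

(* I_U ⊗ tau_{V,U'} ⊗ I_V', up to associativity (lemma tmidE) *)
Definition tmid (U V U' V' : lmodType k) :
    (U ⊗ V) ⊗ (U' ⊗ V') -> (U ⊗ U') ⊗ (V ⊗ V') :=
  tassocV \o tmap idfun (tassoc \o tmap tflip idfun \o tassocV) \o tassoc.

Arguments tmid {U V U' V'}%_type t.

Lemma tmid_linear (U V U' V' : lmodType k) : linear (@tmid U V U' V').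
Proof. by move=> a s t; rewrite /tmid linearP. Qed.

HB.instance Definition _ (U V U' V' : lmodType k) :=
  GRing.isLinear.Build k ((U ⊗ V) ⊗ (U' ⊗ V'))%type ((U ⊗ U') ⊗ (V ⊗ V'))%type
    *:%R tmid (@tmid_linear U V U' V').

Lemma tmidE (U V U' V' : lmodType k) (u : U) (v : V) (u' : U') (v' : V') :
  tmid ((u ⊗ v) ⊗ (u' ⊗ v')) = (u ⊗ u') ⊗ (v ⊗ v').
Proof.
by rewrite /tmid /= tassocE tmapE /= tassocVE tmapE /= tflipE tassocE tassocVE.
Qed.

End TensorMapsTheory.

Arguments tmid {k} {U V U' V'}%_type t.

(* An algebra (A, m, u) is given by its multiplication m : A ⊗ A -> A and its
   unit element. MathComp's [algType] is not used because it requires 1 != 0,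
   which would exclude the zero algebra. *)
HB.mixin Record isTAlgebra (k : fieldType) A of GRing.Lmodule k A := {
  amul : {linear (A ⊗ A)%type -> A};
  aone : A;
  amulA : forall x y z : A, amul (x ⊗ amul (y ⊗ z)) = amul (amul (x ⊗ y) ⊗ z);
  amul1l : forall x : A, amul (aone ⊗ x) = x;
  amul1r : forall x : A, amul (x ⊗ aone) = x
}.

#[short(type="tAlgType")]
HB.structure Definition TAlgebra (k : fieldType) :=
  {A of GRing.Lmodule k A & isTAlgebra k A}.

Notation "x • y" := (amul (x ⊗ y)) : ring_scope.

Section TensorAlgebra.
Context (k : fieldType) (A B : tAlgType k).

Definition tensor_one : A ⊗ B := aone ⊗ aone.

Definition tensor_mul : (A ⊗ B) ⊗ (A ⊗ B) -> A ⊗ B := tmap amul amul \o tmid.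

Lemma tensor_mul_linear : linear tensor_mul.
Proof. by move=> a s t; rewrite /tensor_mul linearP. Qed.

HB.instance Definition _ := GRing.isLinear.Build k
  ((A ⊗ B) ⊗ (A ⊗ B))%type (A ⊗ B)%type *:%R tensor_mul tensor_mul_linear.

Lemma tensor_mulE (x x' : A) (y y' : B) :
  tensor_mul ((x ⊗ y) ⊗ (x' ⊗ y')) = (x • x') ⊗ (y • y').
Proof. by rewrite /tensor_mul /= tmidE tmapE. Qed.

Lemma tensor_mul1l (t : A ⊗ B) : tensor_mul (tensor_one ⊗ t) = t.
Proof.
elim/tensor_ind: t => [|s t IHs IHt|x y]; first by rewrite pure0r linear0.
  by rewrite pureDr linearD /= IHs IHt.
by rewrite tensor_mulE !amul1l.
Qed.

Lemma tensor_mul1r (t : A ⊗ B) : tensor_mul (t ⊗ tensor_one) = t.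
Proof.
elim/tensor_ind: t => [|s t IHs IHt|x y]; first by rewrite pure0l linear0.
  by rewrite pureDl linearD /= IHs IHt.
by rewrite tensor_mulE !amul1r.
Qed.

Lemma tensor_mulA (s t u : A ⊗ B) :
  tensor_mul (s ⊗ tensor_mul (t ⊗ u)) = tensor_mul (tensor_mul (s ⊗ t) ⊗ u).
Proof.
elim/tensor_ind: s => [|s s' IHs IHs'|x y].
- by rewrite !(pure0l, linear0).
- by rewrite !(pureDl, linearD) /= IHs IHs' -linearD -pureDl -linearD -pureDl.
elim/tensor_ind: t => [|t t' IHt IHt'|x' y'].
- by rewrite !(pure0l, pure0r, linear0).
- by rewrite !(pureDl, pureDr, linearD) /= IHt IHt'.
elim/tensor_ind: u => [|u u' IHu IHu'|x'' y''].
- by rewrite !(pure0r, linear0).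
- by rewrite !(pureDr, linearD) /= IHu IHu'.
by rewrite !tensor_mulE !amulA.
Qed.

HB.instance Definition _ := isTAlgebra.Build k (A ⊗ B)%type
  tensor_mulA tensor_mul1l tensor_mul1r.

End TensorAlgebra.

HB.mixin Record isCoalgebra (k : fieldType) C of GRing.Lmodule k C := {
  comul : {linear C -> (C ⊗ C)%type};
  counit : {linear C -> k^o};
  comulA : forall c : C,
    tassoc (tmap comul idfun (comul c)) = tmap idfun comul (comul c);
  counitl : forall c : C, tlunit (tmap counit idfun (comul c)) = c;
  counitr : forall c : C, trunit (tmap idfun counit (comul c)) = c
}.

#[short(type="coalgType")]
HB.structure Definition Coalgebra (k : fieldType) :=
  {C of GRing.Lmodule k C & isCoalgebra k C}.

HB.mixin Record isWeakBialgebra (k : fieldType) H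
    of TAlgebra k H & Coalgebra k H := {
  comulM : forall h g : H, comul (h • g) = comul h • comul g;
  counitM12 : forall h g l : H, counit (h • g • l) =
    \sweedler_(g1; g2 <- comul g) (counit (h • g1) * counit (g2 • l));
  counitM21 : forall h g l : H, counit (h • g • l) =
    \sweedler_(g1; g2 <- comul g) (counit (h • g2) * counit (g1 • l));
  comul1_rl : ((aone : H) ⊗ comul (aone : H)) • tassoc (comul (aone : H) ⊗ (aone : H)) =
    tassoc (tmap comul idfun (comul (aone : H)));
  comul1_lr : tassoc (comul (aone : H) ⊗ (aone : H)) • ((aone : H) ⊗ comul (aone : H)) =
    tassoc (tmap comul idfun (comul (aone : H)))
}.

#[short(type="weakBialgType")]
HB.structure Definition WeakBialgebra (k : fieldType) :=
  {H of TAlgebra k H & Coalgebra k H & isWeakBialgebra k H}.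

Section CounitMaps.
Context (k : fieldType) (H : weakBialgType k).

Definition counit_t (h : H) : H :=
  \sweedler_(x; y <- comul (aone : H)) (counit (x • h) : k) *: y.

Definition counit_s (h : H) : H :=
  \sweedler_(x; y <- comul (aone : H)) (counit (h • y) : k) *: x.

Lemma counit_t_linear : linear counit_t.
Proof.
apply: sweedler_linear_param => x y a h g.
by rewrite purePr !linearP scalerDl scalerA.
Qed.

HB.instance Definition _ :=
  GRing.isLinear.Build k H H *:%R counit_t counit_t_linear.

Lemma counit_s_linear : linear counit_s.
Proof.
apply: sweedler_linear_param => x y a h g.
by rewrite purePl !linearP scalerDl scalerA.
Qed.

HB.instance Definition _ :=
  GRing.isLinear.Build k H H *:%R counit_s counit_s_linear.

End CounitMaps.

HB.mixin Record hasAntipode (k : fieldType) H of WeakBialgebra k H := {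
  antipode : {linear H -> H};
  antipode_t : forall h : H,
    \sweedler_(h1; h2 <- comul h) h1 • antipode h2 = counit_t h;
  antipode_s : forall h : H,
    \sweedler_(h1; h2 <- comul h) antipode h1 • h2 = counit_s h;
  antipodeK : forall h : H,
    \sweedler_(h1; h23 <- comul h) \sweedler_(h2; h3 <- comul h23)
      antipode h1 • h2 • antipode h3 = antipode h
}.

#[short(type="weakHopfAlgType")]
HB.structure Definition WeakHopfAlgebra (k : fieldType) :=
  {H of WeakBialgebra k H & hasAntipode k H}.

(* A subspace D = {c | P c} of C is a subcoalgebra when the coalgebra structure
   of C restricts to D: the inclusion [val] is a morphism of coalgebras. As
   [val] ⊗ [val] is injective over a field, the comultiplication of D is the
   corestriction of that of C, whose values on D thus lie in D ⊗ D. *)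
HB.mixin Record isSubCoalgebra (k : fieldType) (C : coalgType k) (P : pred C) D
    of @GRing.SubLmodule k C P D & Coalgebra k D := {
  val_comul : forall d : D,
    tmap (val : D -> C) (val : D -> C) (comul d) = comul (val d);
  val_counit : forall d : D, counit d = counit (val d) :> k
}.

#[short(type="subCoalgType")]
HB.structure Definition SubCoalgebra (k : fieldType) (C : coalgType k)
    (P : pred C) :=
  {D of @GRing.SubLmodule k C P D & Coalgebra k D & isSubCoalgebra k C P D}.

Section Corestriction.
Context (k : fieldType) (U V : lmodType k) (P : pred V) (D : subLmodType P).
Context (f : {linear U -> V}) (fP : forall u, f u \in P).

Definition corestrict_fun (u : U) : D := Sub (f u) (fP u).

Lemma val_corestrict_fun u : val (corestrict_fun u) = f u.
Proof. exact: SubK. Qed.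

Lemma corestrict_linear : linear corestrict_fun.
Proof.
by move=> a u v; apply: val_inj; rewrite linearP /= !val_corestrict_fun linearP.
Qed.

HB.instance Definition _ :=
  GRing.isLinear.Build k U D *:%R corestrict_fun corestrict_linear.

Definition corestrict : {linear U -> D} := [the {linear U -> D} of corestrict_fun].

Lemma val_corestrict u : val (corestrict u) = f u.
Proof. exact: val_corestrict_fun. Qed.

End Corestriction.

Arguments corestrict {k U V P} D {f} fP.

Record projection_onto (V : Type) (P : pred V) (p : V -> V) : Prop := {
  projection_idem : forall v, p (p v) = p v;
  projection_im : forall v, v \in P <-> exists u, p u = v
}.

Lemma projection_in (V : Type) (P : pred V) (p : V -> V) :
  projection_onto P p -> forall v, p v \in P.
Proof. by move=> pP v; apply/(projection_im pP); exists v. Qed.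

Section Comodule.
Context (k : fieldType) (H : weakBialgType k).

(* m_H ⊗ I_X, up to associativity *)
Definition tmull (X : lmodType k) : H ⊗ H ⊗ X -> H ⊗ X :=
  tmap amul idfun \o tassocV.

Lemma tmull_linear (X : lmodType k) : linear (@tmull X).
Proof. by move=> a s t; rewrite /tmull linearP. Qed.

HB.instance Definition _ (X : lmodType k) := GRing.isLinear.Build k
  (H ⊗ H ⊗ X)%type (H ⊗ X)%type *:%R (@tmull X) (@tmull_linear X).

Lemma tmullE (X : lmodType k) (g h : H) (x : X) :
  tmull (g ⊗ h ⊗ x) = (g • h) ⊗ x.
Proof. by rewrite /tmull /= tassocVE tmapE. Qed.

(* (m_H ⊗ I_C ⊗ I_C)(I_H ⊗ tau_{C,H} ⊗ I_C)(rho ⊗ rho) Δ_C *)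
Definition codiagonal_coaction (C : coalgType k) (rho : {linear C -> (H ⊗ C)%type})
    (c : C) : H ⊗ C ⊗ C :=
  tmap amul idfun (tmid (tmap rho rho (comul c))).

Record comodule_coalgebra (C : coalgType k) (rho : {linear C -> (H ⊗ C)%type}) :
    Prop := {
  CC1 : forall c, tlunit (tmap counit idfun (rho c)) = c;
  CC2 : forall c, tmap idfun comul (rho c) = codiagonal_coaction rho c;
  CC3 : forall c, tmap idfun rho (rho c) = tassoc (tmap comul idfun (rho c));
  CC4 : forall c, tmap idfun counit (rho c) = tmap (@counit_t k H) counit (rho c)
}.

(* (I_H ⊗ ε_D) rho, with H ⊗ k identified with H *)
Definition coaction_counit (D : coalgType k) (rho : {linear D -> (H ⊗ D)%type}) :
    D -> H := trunit \o tmap idfun counit \o rho.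

Lemma coaction_counit_linear (D : coalgType k)
  (rho : {linear D -> (H ⊗ D)%type}) : linear (coaction_counit rho).
Proof. by move=> a s t; rewrite /coaction_counit linearP. Qed.

HB.instance Definition _ (D : coalgType k) (rho : {linear D -> (H ⊗ D)%type}) :=
  GRing.isLinear.Build k D H *:%R
    (coaction_counit rho) (coaction_counit_linear rho).

(* (Δ_H ⊗ I_D) rho, up to associativity *)
Definition coaction_comul (D : coalgType k) (rho : {linear D -> (H ⊗ D)%type}) :
    D -> H ⊗ H ⊗ D := tassoc \o tmap comul idfun \o rho.

Lemma coaction_comul_linear (D : coalgType k)
  (rho : {linear D -> (H ⊗ D)%type}) : linear (coaction_comul rho).
Proof. by move=> a s t; rewrite /coaction_comul linearP. Qed.

HB.instance Definition _ (D : coalgType k) (rho : {linear D -> (H ⊗ D)%type}) :=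
  GRing.isLinear.Build k D (H ⊗ H ⊗ D)%type *:%R
    (coaction_comul rho) (coaction_comul_linear rho).

Record partial_comodule_coalgebra (D : coalgType k)
    (rho : {linear D -> (H ⊗ D)%type}) : Prop := {
  CCP1 : forall d, tlunit (tmap counit idfun (rho d)) = d;
  CCP2 : forall d, tmap idfun comul (rho d) = codiagonal_coaction rho d;
  CCP3 : forall d, tmap idfun rho (rho d) =
    tmull (tmap (coaction_counit rho) (coaction_comul rho) (comul d))
}.

Record symmetric_partial_comodule_coalgebra (D : coalgType k)
    (rho : {linear D -> (H ⊗ D)%type}) : Prop := {
  symmetric_partial :> partial_comodule_coalgebra rho;
  (* (m_H ⊗ I ⊗ I)(I ⊗ tau_{H ⊗ D, H})[(Δ_H ⊗ I)(rho d1) ⊗ (I ⊗ ε_D)(rho d2)] *)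
  CCPsym : forall d, tmap idfun rho (rho d) =
    tmull (tmap idfun tflip
      (tassoc (tmap (coaction_comul rho) (coaction_counit rho) (comul d))))
}.

End Comodule.

Arguments tmull {k H} {X}%_type t.

(* Main.v *)
Require Import Defs.
From mathcomp Require Import all_boot all_order all_algebra.

(** Write rhob for the candidate coaction (I ⊗ piD) rho restricted to D.
    Each axiom of a symmetric partial comodule coalgebra, evaluated at rhob and
    written out in Sweedler notation, is one of the displayed conditions, for
    each element d separately; the equivalence therefore holds axiom by axiom.

    - Counitality of rhob always holds: counitality of rho gives
      (ε ⊗ I) rhob = piD on D, and a projection onto D fixes D.
    - Compatibility of rhob with Δ is condition (i).  Its left sides agree by
      definition.  On the right side, the inclusion of D is a coalgebra map, so
      the codiagonal coaction of rhob is (I ⊗ piD ⊗ piD) applied to the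
      codiagonal coaction of rho ([codiagonal_coaction_pushforward]), which the
      same compatibility for rho turns into (I ⊗ Δ) rho.
    - The two coassociativity axioms share their left side, which is the left
      side of (ii) ([iterated_pushforward]).  Their right sides are the two
      other members of (ii) ([coassoc_left_pushforward],
      [coassoc_right_pushforward]).

    The expansions never change a decomposition of a tensor into pure tensors:
    I ⊗ piD acts summand by summand, and sums are only moved out of linear maps
    and out of tensor products.  Only the codiagonal coaction and counitality,
    where two maps have to be compared on a whole tensor product, are checked on
    pure tensors. *)

Set Implicit Arguments.
Unset Strict Implicit.
Unset Printing Implicit Defensive.

Import GRing.Theory.
Local Open Scope ring_scope.

(** * Moving Sweedler sums through linear maps *)

Section SweedlerCalculus.
Context (k : fieldType) (V W : lmodType k).
Implicit Type t : V ⊗ W.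

Lemma eq_sweedler (X : zmodType) t (f g : V -> W -> X) :
  (forall v w, f v w = g v w) -> sweedler t f = sweedler t g.
Proof. by move=> fg; apply: eq_bigr => p _. Qed.

(** A Sweedler sum is literally a finite sum over one chosen decomposition of
    the tensor, and F is applied to each summand. *)
Lemma linear_sweedler (X Y : lmodType k) (F : {linear X -> Y}) t
    (f : V -> W -> X) :
  F (sweedler t f) = \sweedler_(v; w <- t) F (f v w).
Proof. exact: linear_sum. Qed.

Lemma sweedler_purel (X Y : lmodType k) t (f : V -> W -> X) (y : Y) :
  sweedler t f ⊗ y = \sweedler_(v; w <- t) (f v w ⊗ y).
Proof.
by apply: (big_morph (fun x : X => x ⊗ y)) => [x x'|]; rewrite (pureDl, pure0l).
Qed.

Lemma sweedler_purer (X Y : lmodType k) t (x : X) (f : V -> W -> Y) :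
  x ⊗ sweedler t f = \sweedler_(v; w <- t) (x ⊗ f v w).
Proof.
by apply: (big_morph (fun y : Y => x ⊗ y)) => [y y'|]; rewrite (pureDr, pure0r).
Qed.

End SweedlerCalculus.

(** * Coactions induced along a pair of linear maps *)

(** The coaction (I ⊗ p) rho i on D is studied for arbitrary linear maps i and
    p; the case of interest is an inclusion i and a projection p. *)
Section Pushforward.
Context (k : fieldType) (H : weakBialgType k) (C D : coalgType k).
Context (rho : {linear C -> (H ⊗ C)%type}).
Context (i : {linear D -> C}) (p : {linear C -> D}).

Local Notation rhob := (tmap idfun p \o rho \o i).

Lemma linear_pushforward (X : lmodType k) (F : {linear (H ⊗ D)%type -> X}) d :
  F (rhob d) = \sweedler_(a; x <- rho (i d)) F (a ⊗ p x).
Proof. exact: linear_sweedler. Qed.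

Lemma iterated_pushforward d :
  tmap idfun rhob (rhob d) =
  \sweedler_(a; x <- rho (i d)) \sweedler_(b; y <- rho (i (p x)))
    (a ⊗ b ⊗ p y).
Proof.
rewrite linear_pushforward; apply: eq_sweedler => a x.
by rewrite /= tmapE /= sweedler_purer.
Qed.

Lemma coaction_counit_pushforward d :
  coaction_counit rhob d =
  \sweedler_(a; x <- rho (i d)) ((counit (p x) : k) *: a).
Proof.
rewrite [LHS](linear_pushforward (trunit \o tmap idfun counit)).
by apply: eq_sweedler => a x; rewrite /= tmapE trunitE.
Qed.

(** The coproduct of the H-leg stays unexpanded: distributing the tensor
    product of two such expressions then produces the sums in the order in which
    they are nested in the coassociativity conditions. *)
Lemma coaction_comul_pushforward d :
  coaction_comul rhob d =
  \sweedler_(a; x <- rho (i d)) tassoc (comul a ⊗ p x).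
Proof.
rewrite [LHS](linear_pushforward (tassoc \o tmap comul idfun)).
by apply: eq_sweedler => a x; rewrite /= tmapE.
Qed.

Lemma tassoc_comul (h : H) (x : D) :
  tassoc (comul h ⊗ x) = \sweedler_(h1; h2 <- comul h) (h1 ⊗ h2 ⊗ x).
Proof.
(* Expanding the tensor along its representative gives exactly its Sweedler
   sum of pure tensors. *)
rewrite {1}[comul h]tensor_sum -/(sweedler _ (fun h1 h2 => h1 ⊗ h2)).
rewrite sweedler_purel linear_sweedler.
by apply: eq_sweedler => h1 h2; rewrite /= tassocE.
Qed.

Lemma coassoc_left_pushforward d :
  tmull (tmap (coaction_counit rhob) (coaction_comul rhob) (comul d)) =
  \sweedler_(d1; d2 <- comul d)
    \sweedler_(a; x <- rho (i d1)) \sweedler_(b; y <- rho (i d2))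
      \sweedler_(b1; b2 <- comul b)
        ((counit (p x) : k) *: (a • b1) ⊗ b2 ⊗ p y).
Proof.
rewrite [LHS](linear_sweedler tmull); apply: eq_sweedler => d1 d2.
rewrite coaction_counit_pushforward coaction_comul_pushforward.
rewrite sweedler_purel linear_sweedler; apply: eq_sweedler => a x.
rewrite sweedler_purer linear_sweedler; apply: eq_sweedler => b y.
rewrite tassoc_comul sweedler_purer linear_sweedler.
by apply: eq_sweedler => b1 b2; rewrite /= tmullE pureZl linearZ.
Qed.

(** The coproduct is taken in the first factor here, so the sum over it, though
    nested innermost, is pulled out of the left side of the tensor product after
    the sum over b and y has been pulled out of the right side. *)
Lemma coassoc_right_pushforward d :
  tmull (tmap idfun tflip
    (tassoc (tmap (coaction_comul rhob) (coaction_counit rhob) (comul d)))) =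
  \sweedler_(d1; d2 <- comul d)
    \sweedler_(a; x <- rho (i d1)) \sweedler_(b; y <- rho (i d2))
      \sweedler_(a1; a2 <- comul a)
        ((counit (p y) : k) *: (a1 • b) ⊗ a2 ⊗ p x).
Proof.
rewrite [LHS](linear_sweedler (tmull \o tmap idfun tflip \o tassoc)).
apply: eq_sweedler => d1 d2.
rewrite coaction_counit_pushforward coaction_comul_pushforward.
rewrite sweedler_purel !linear_sweedler; apply: eq_sweedler => a x.
rewrite sweedler_purer !linear_sweedler; apply: eq_sweedler => b y.
rewrite tassoc_comul sweedler_purel !linear_sweedler.
apply: eq_sweedler => a1 a2.
by rewrite /= (tassocE a1 (a2 ⊗ p x)) tmapE /= tflipE tmullE pureZr linearZ.
Qed.

(** As i is comultiplicative, the coproduct of D may be replaced by that of C;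
    the two copies of p then act on legs that the codiagonal coaction neither
    multiplies nor merges, so they can be applied last. *)
Lemma codiagonal_coaction_pushforward d :
  tmap i i (comul d) = comul (i d) ->
  codiagonal_coaction rhob d =
  tmap idfun (tmap p p) (codiagonal_coaction rho (i d)).
Proof.
rewrite /codiagonal_coaction => <-.
elim/tensor_ind: (comul d) => [|s t IHs IHt|d1 d2].
- by rewrite !linear0.
- by rewrite !linearD /= IHs IHt.
rewrite !tmapE /=.
elim/tensor_ind: (rho (i d1)) => [|s t IHs IHt|a x].
- by rewrite !(linear0, pure0l).
- by rewrite !(linearD, pureDl) /= IHs IHt.
elim/tensor_ind: (rho (i d2)) => [|s t IHs IHt|b y].
- by rewrite !(linear0, pure0r).
- by rewrite !(linearD, pureDr) /= IHs IHt.
by rewrite !(tmapE, tmidE) /= tmapE.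
Qed.

End Pushforward.

(** * The characterization *)

Lemma projection_fix (V : Type) (P : pred V) (p : V -> V) v :
  projection_onto P p -> v \in P -> p v = v.
Proof. by move=> pP /(projection_im pP)[u <-]; exact: projection_idem pP u. Qed.

Theorem proposition3p15 (k : fieldType) (H : weakHopfAlgType k)
    (C : coalgType k) (rho : {linear C -> (H ⊗ C)%type})
    (rhoP : comodule_coalgebra rho)
    (P : pred C) (D : subCoalgType P)
    (pi : {linear C -> C}) (piP : projection_onto P pi) :
  let piD := corestrict D (projection_in piP) in
  symmetric_partial_comodule_coalgebra (tmap idfun piD \o rho \o val)
  <->
  (forall d : D,
     \sweedler_(a; x <- rho (val d)) (a ⊗ comul (piD x)) =
     \sweedler_(a; x <- rho (val d)) (a ⊗ tmap piD piD (comul x)))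
  /\
  (forall d : D,
     \sweedler_(a; x <- rho (val d))
       \sweedler_(b; y <- rho (pi x)) (a ⊗ b ⊗ piD y) =
     \sweedler_(d1; d2 <- comul d)
       \sweedler_(a; x <- rho (val d1)) \sweedler_(b; y <- rho (val d2))
         \sweedler_(b1; b2 <- comul b)
           ((counit (piD x) : k) *: (a • b1) ⊗ b2 ⊗ piD y)
     /\
     \sweedler_(d1; d2 <- comul d)
       \sweedler_(a; x <- rho (val d1)) \sweedler_(b; y <- rho (val d2))
         \sweedler_(b1; b2 <- comul b)
           ((counit (piD x) : k) *: (a • b1) ⊗ b2 ⊗ piD y) =
     \sweedler_(d1; d2 <- comul d)
       \sweedler_(a; x <- rho (val d1)) \sweedler_(b; y <- rho (val d2))
         \sweedler_(a1; a2 <- comul a)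
           ((counit (piD y) : k) *: (a1 • b) ⊗ a2 ⊗ piD x)).
Proof.
move=> piD.
have val_piD x : val (piD x) = pi x by exact: val_corestrict.
have counital (d : D) : tlunit (tmap counit idfun
    ((tmap idfun piD \o rho \o val) d)) = d.
  (* piD slides out past the counit, leaving counitality of rho. *)
  transitivity (piD (tlunit (tmap counit idfun (rho (val d))))).
    rewrite /=; elim/tensor_ind: (rho (val d)) => [|s t IHs IHt|a x].
    - by rewrite !linear0.
    - by rewrite !linearD /= IHs IHt.
    - by rewrite !tmapE !tlunitE linearZ.
  rewrite (CC1 rhoP); apply: val_inj.
  by rewrite val_piD; apply: (projection_fix piP); exact: valP.
have comulL (d : D) : tmap idfun comul ((tmap idfun piD \o rho \o val) d) =
    \sweedler_(a; x <- rho (val d)) (a ⊗ comul (piD x)).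
  rewrite [LHS](linear_pushforward rho val piD (tmap idfun comul)).
  by apply: eq_sweedler => a x; rewrite /= tmapE.
have comulR (d : D) : codiagonal_coaction (tmap idfun piD \o rho \o val) d =
    \sweedler_(a; x <- rho (val d)) (a ⊗ tmap piD piD (comul x)).
  rewrite [LHS](codiagonal_coaction_pushforward rho piD (val_comul d)).
  rewrite -(CC2 rhoP).
  by rewrite linear_sweedler; apply: eq_sweedler => a x; rewrite /= tmapE.
have iterated (d : D) : tmap idfun (tmap idfun piD \o rho \o val)
      ((tmap idfun piD \o rho \o val) d) =
    \sweedler_(a; x <- rho (val d))
      \sweedler_(b; y <- rho (pi x)) (a ⊗ b ⊗ piD y).
  rewrite [LHS](iterated_pushforward rho val piD).
  by apply: eq_sweedler => a x; rewrite /= val_piD.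
split=> [[[_ comul_ax left_ax] right_ax]|[comul_cond coassoc_cond]].
  split=> d; first by rewrite -comulL -comulR; exact: comul_ax.
  rewrite -iterated -(coassoc_left_pushforward rho val piD d).
  rewrite -(coassoc_right_pushforward rho val piD d).
  by split; rewrite -?left_ax.
split; first split.
- exact: counital.
- by move=> d; rewrite comulL comulR.
- by move=> d; rewrite iterated coassoc_left_pushforward (coassoc_cond d).1.
- move=> d; rewrite iterated coassoc_right_pushforward.
  by rewrite (coassoc_cond d).1 (coassoc_cond d).2.
Qed.
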